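(* Let $\delta>0$, $r\in\mathbb{N}\cup\{\infty\}$, and let $f:[0,\delta)\to\mathbb{R}$ be continuous on $[0,\delta)$ and a $C^r$-diffeomorphism on $(0,\delta)$ (onto its image), positive on $(0,\delta)$, with $f(0)=0$ and $f'(0)=0$, where $f'(0)=0$ means $\lim_{x\to0+}f'(x)=0$. Assume that $f$ is sublinear. Let $g=\mathrm{id}-f$. Then for any initial point $x_0>0$ sufficiently close to $0$, $$|S^g(x_0)_\varepsilon|\simeq f^{-1}(\varepsilon),\qquad \varepsilon\to0.$$
   Context: A positive function $f$ on $(0,\delta)$ is called sublinear if there exist $\delta_1>0$ and a constant $m>1$ such that $m\le x\,(\log f)'(x)$ for all $x\in(0,\delta_1)$. For $x_0\in(0,\delta)$, the orbit is $S^g(x_0)=\{x_n:\ n\in\mathbb{N}_0\}$ with $x_{n+1}=g(x_n)$. For a bounded set $U\subset\mathbb{R}$, $U_\varepsilon=\{x\in\mathbb{R}:\ d(x,U)\le\varepsilon\}$ is its $\varepsilon$-neighborhood and $|U_\varepsilon|$ its Lebesgue measure. For positive functions, $F(\varepsilon)\simeq G(\varepsilon)$ as $\varepsilon\to0$ means that there exist constants $A,B>0$ and $\varepsilon_0>0$ such that $A\le F(\varepsilon)/G(\varepsilon)\le B$ for all $\varepsilon\in(0,\varepsilon_0)$. *)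

(* Defs.v *)
From mathcomp Require Import all_boot all_order all_algebra.
From mathcomp Require Import all_classical all_reals all_analysis.
Import Order.TTheory GRing.Theory Num.Theory.
Import numFieldNormedType.Exports.

Set Implicit Arguments.
Unset Strict Implicit.
Unset Printing Implicit Defensive.

Local Open Scope ring_scope.
Local Open Scope classical_set_scope.

(* A regularity r in N \cup {oo} is an [option nat], with [None] for oo. *)
Definition le_reg (n : nat) (r : option nat) : bool :=
  if r is Some k then (n <= k)%N else true.

(* The iterated derivatives [h^`(n)] are two-sided, so this is the usual notion
   when U is open. *)
Definition Cr_on (R : realType) (r : option nat) (U : set R) (h : R -> R) : Prop :=
  (forall n x, le_reg n.+1 r -> U x -> derivable (h^`(n)) x 1) /\
  (forall n x, le_reg n r -> U x -> {for x, continuous (h^`(n))}).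

(* [pinv U h] is the inverse of the restriction of h to U.  For U an open
   interval, h @` U is open as well, h being continuous and injective on U. *)
Definition Cr_diffeo_on (R : realType) (r : option nat) (U : set R)
    (h : R -> R) : Prop :=
  [/\ {in U &, injective h}, Cr_on r U h & Cr_on r (h @` U) (pinv U h)].

Definition sublinear (R : realType) (delta : R) (f : R -> R) : Prop :=
  exists delta1 m : R, [/\ 0 < delta1, delta1 <= delta, 1 < m &
    forall x, 0 < x < delta1 -> m <= x * derive1 (fun t => ln (f t)) x].

Definition orbit_set (R : realType) (g : R -> R) (x0 : R) : set R :=
  [set iter n g x0 | n in [set: nat]].

Definition eps_nbhd (R : realType) (U : set R) (eps : R) : set R :=
  [set x | (edist_inf U x <= eps%:E)%E].

Definition simeq0 (R : realType) (F G : R -> R) : Prop :=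
  exists A B eps0 : R, [/\ 0 < A, 0 < B, 0 < eps0 &
    forall eps, 0 < eps < eps0 -> A <= F eps / G eps <= B].

(* Main.v *)
(* Near 0, f is increasing and f x <= x / 2, so the orbit decreases to 0 with
   consecutive gaps f (x_n).  Put a = f^-1(eps) and let N be the first index with
   x_N <= a; then a / 2 <= x_N.  Beyond N the gaps are at most eps, so ]0, x_N]
   lies in the eps-neighborhood: this is the lower bound.  The neighborhood is
   covered by an interval of length x_N + 4 eps and N intervals of length 4 eps
   (radius 2 eps, since the infimum defining the distance need not be attained),
   so the upper bound amounts to N eps = O(a).  Sublinearity gives
   (x / f x)' <= - (m - 1) / f x, hence x / f x grows by at least m - 1 at each
   step of the orbit, and (m - 1) (N - 1) <= x_(N-1) / f (x_(N-1)) <= a / eps. *)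
Require Import Defs.
From mathcomp Require Import all_boot all_order all_algebra.
From mathcomp Require Import all_classical all_reals all_analysis.
From mathcomp Require Import measurable_realfun ring lra.
Import Order.TTheory GRing.Theory Num.Theory.
Import numFieldNormedType.Exports.
Local Open Scope ring_scope.
Local Open Scope classical_set_scope.

(** * Measure of the neighborhood of a sequence *)

Lemma measurable_eps_nbhd (R : realType) (U : set R) (eps : R) :
  measurable (eps_nbhd U eps).
Proof.
apply: closed_measurable.
apply: (@preimage_closed _ _ (edist_inf U) [set y | (y <= eps%:E)%E]).
  by move=> x _; exact: edist_inf_continuous.
exact: closed_ereal_ge_ereal.
Qed.

Lemma eps_nbhd_mem (R : realType) (U : set R) (eps x u : R) :
  U u -> 0 < eps -> `|x - u| < eps -> eps_nbhd U eps x.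
Proof.
move=> Uu eps0 xu; apply: (@le_trans _ _ (edist (x, u))).
  by apply: ereal_inf_lbound; exists u.
exact: edist_fin.
Qed.

Lemma eps_nbhd_close (R : realType) (U : set R) (eps eps' x : R) :
  eps < eps' -> eps_nbhd U eps x -> exists2 u, U u & `|x - u| < eps'.
Proof.
move=> ltee xU; have : (edist_inf U x < eps'%:E)%E.
  by rewrite (le_lt_trans xU)// lte_fin.
by case/ereal_inf_lt => _ [u Uu <-] /edist_lt_ball xu; exists u.
Qed.

Lemma lebesgue_measure_itvcc (R : realType) (a b : R) : a <= b ->
  lebesgue_measure `[a, b] = (b - a)%:E.
Proof.
move=> ab; rewrite lebesgue_measure_itv/= lte_fin.
by case: ltgtP ab => // -> _; rewrite subrr.
Qed.

Lemma eps_nbhd_measure_le (R : realType) (u : nat -> R) (N : nat) (eps : R) :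
  0 < eps -> (forall n, 0 < u n) -> (forall n, (N <= n)%N -> u n <= u N) ->
  (lebesgue_measure (eps_nbhd [set u n | n in [set: nat]] eps) <=
   (u N + 4 * eps + N%:R * (4 * eps))%:E)%E.
Proof.
move=> eps0 u0 uN.
pose C n : set R := `[u n - 2 * eps, u n + 2 * eps].
pose tail : set R := `[- (2 * eps), u N + 2 * eps].
have mC n : measurable (C n) by exact: measurable_itv.
have mtail : measurable tail by exact: measurable_itv.
have mU : measurable (\big[setU/set0]_(i < N) C i) by exact: bigsetU_measurable.
apply: (@le_trans _ _ (lebesgue_measure (tail `|` \big[setU/set0]_(i < N) C i))).
  apply: le_measure; rewrite ?inE//=.
  - exact: measurable_eps_nbhd.
  - exact: measurableU.
  (* The terms from index [N] on lie in ]0, u N], so [tail] contains the balls of radius [2 * eps]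
     around all of them. *)
  - move=> x /(@eps_nbhd_close _ _ _ (2 * eps)) []; first by lra.
    move=> _ [n _ <-]; rewrite ltr_norml => /andP[h1 h2].
    have [nN|Nn] := ltnP n N.
      right; rewrite -bigcup_mkord; exists n => //.
      by rewrite /C/= in_itv/=; lra.
    by left; have := uN _ Nn; have := u0 n; rewrite /tail/= in_itv/=; lra.
apply: (@le_trans _ _ (lebesgue_measure tail +
    lebesgue_measure (\big[setU/set0]_(i < N) C i))%E); first exact: measureU2.
rewrite EFinD; apply: leeD.
  by rewrite lebesgue_measure_itvcc ?lee_fin; have := u0 N; lra.
apply: (@le_trans _ _ (\sum_(i < N) lebesgue_measure (C i))%E).
  by apply: (@Boole_inequality _ _ _ lebesgue_measure C N) => i _; exact: mC.
rewrite (eq_bigr (fun=> (4 * eps)%:E)) => [|i _].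
  by rewrite sumEFin lee_fin sumr_const card_ord (mulr_natl (4 * eps)).
by rewrite /C lebesgue_measure_itvcc; [congr EFin; lra|lra].
Qed.

Lemma eps_nbhd_measure_ge (R : realType) (u : nat -> R) (N : nat) (eps : R) :
  0 < eps -> 0 < u N ->
  (forall n, (N <= n)%N -> u n - u n.+1 <= eps) ->
  (forall y, 0 < y -> exists n, u n < y) -> {homo u : m n / (m <= n)%N >-> n <= m} ->
  ((u N)%:E <= lebesgue_measure (eps_nbhd [set u n | n in [set: nat]] eps))%E.
Proof.
move=> eps0 uN0 gap u_to0 u_noninc.
have -> : (u N)%:E = lebesgue_measure (`]0, u N] : set R).
  by rewrite lebesgue_measure_itv/= lte_fin uN0 sube0.
apply: le_measure; rewrite ?inE/=.
- exact: measurable_itv.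
- exact: measurable_eps_nbhd.
move=> y /=; rewrite in_itv/= => /andP[y0 yN].
have exn : exists n, u n < y by exact: u_to0.
(* At the first index [n.+1] whose term is below [y], the point [y] lies in the gap ]u n.+1, u n].
   Index 0 is impossible, as [y <= u N <= u 0]. *)
case: (ex_minnP exn) => -[|n] un nmin.
  by have := u_noninc _ _ (leq0n N); lra.
have yn : y <= u n by rewrite leNgt; apply/negP => /nmin/[!ltnn].
have Nn : (N <= n)%N.
  rewrite leqNgt; apply/negP => nN.
  by have := u_noninc _ _ nN; lra.
apply: (@eps_nbhd_mem _ _ _ _ (u n)) => //.
by have := gap _ Nn; rewrite ltr_norml; lra.
Qed.

(** * Orbits of [x - f x] *)

Section orbit.
Context (R : realType) (d m : R) (f : R -> R).
Hypotheses (m1 : 1 < m) (f_pos : forall x : R, 0 < x < d -> 0 < f x)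
  (f_incr : forall x y : R, 0 < x -> x <= y -> y < d -> f x <= f y)
  (f_half : forall x : R, 0 < x < d -> f x <= x / 2)
  (f_ratio : forall x y : R, 0 < x -> x < y -> y < d ->
     (m - 1) * (y - x) / f y <= x / f x - y / f y).
Variable x0 : R.
Hypothesis x0d : 0 < x0 < d.

Let u n := iter n (fun x => x - f x) x0.

Lemma orbit_in n : 0 < u n < d.
Proof.
elim: n => // n; rewrite /u iterS -/(u n) => un.
by have := f_pos _ un; have := f_half _ un; lra.
Qed.

Lemma orbit_noninc : {homo u : p n / (p <= n)%N >-> n <= p}.
Proof.
apply/nonincreasing_seqP => n; rewrite /u iterS -/(u n).
by have := f_pos _ (orbit_in n); lra.
Qed.

Lemma orbit_incr p n : (p <= n)%N -> f (u n) <= f (u p).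
Proof.
move=> pn; have /andP[? _] := orbit_in n; have /andP[_ ?] := orbit_in p.
by apply: f_incr => //; exact: orbit_noninc.
Qed.

(** If the orbit stayed above [y], monotonicity of [f] would make every step at least [f y], and the
    orbit would decrease at least linearly, against the Archimedean property. *)
Lemma orbit_to0 (y : R) : 0 < y -> exists n, u n < y.
Proof.
move=> y0; apply/not_existsP => /= uy.
have {}uy n : y <= u n by rewrite leNgt; exact/negP/uy.
have yd : 0 < y < d by have := uy 0%N; have := orbit_in 0; lra.
have fy := f_pos _ yd.
have un n : u n <= x0 - n%:R * f y.
  elim: n => [|n IH]; first by rewrite mul0r subr0.
  have : f y <= f (u n).
    by apply: f_incr => //; case/andP: (orbit_in n).
  by rewrite /u iterS -/(u n) -natr1; lra.
have x0fy : 0 <= x0 / f y by case/andP: x0d => /ltW x0_ge0 _; rewrite divr_ge0// ltW.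
have := archi_boundP x0fy; set n := Num.bound _.
by rewrite ltr_pdivrMr//; have := un n; have := uy n; lra.
Qed.

(** In [f_ratio] at consecutive orbit points, [y - x] is exactly [f y], so the quotient cancels and
    each step adds at least [m - 1]. *)
Lemma orbit_ratio n : n%:R * (m - 1) <= u n / f (u n).
Proof.
have fu k := f_pos _ (orbit_in k).
elim: n => [|n IH].
  by rewrite mul0r divr_ge0 ?ltW//; case/andP: (orbit_in 0).
have unS : u n - u n.+1 = f (u n) by rewrite /u iterS -/(u n); lra.
have /andP[un0 und] := orbit_in n; have /andP[unS0 _] := orbit_in n.+1.
have := @f_ratio (u n.+1) (u n) unS0; rewrite unS mulfK ?gt_eqF//.
by rewrite -natr1 => /(_ _ und); have := fu n; lra.
Qed.

(** The left side of [f_ratio] is nonnegative. This passes from an orbit point to the nearby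
    preimage of [eps]. *)
Lemma ratio_noninc (a x : R) : 0 < a -> a <= x -> x < d -> x / f x <= a / f a.
Proof.
move=> a0; rewrite le_eqVlt => /predU1P[->//|ax] xd.
have := f_ratio _ _ a0 ax xd; suff : 0 <= (m - 1) * (x - a) / f x by lra.
by rewrite divr_ge0 ?mulr_ge0 ?subr_ge0 ?ltW// f_pos//; lra.
Qed.

Lemma orbit_nbhd_measure (a : R) : 0 < a -> a < x0 ->
  ((a / 2)%:E <= lebesgue_measure (eps_nbhd [set u n | n in [set: nat]] (f a))
    <= ((5 + 4 / (m - 1)) * a)%:E)%E.
Proof.
move=> a0 ax0; have ad : 0 < a < d by rewrite a0 (lt_trans ax0); case/andP: x0d.
have fa0 := f_pos _ ad; have fah := f_half _ ad.
have exN : exists n, u n <= a.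
  by have [n /ltW un] := orbit_to0 _ a0; exists n.
(* Index 0 is excluded by [a < x0], so the first index is some [M.+1] and [u M] is still above
   [a]. *)
case: (ex_minnP exN) => -[|M] uN Nmin; first exfalso.
  by move: uN; rewrite leNgt ax0.
have uM : a < u M by rewrite ltNge; apply/negP => /Nmin; rewrite ltnn.
have uMd := orbit_in M; have uNd := orbit_in M.+1.
apply/andP; split.
  apply: (@le_trans _ _ (u M.+1)%:E).
    (* A step at most halves the point: [u M.+1 = u M - f (u M) >= u M / 2 > a / 2]. *)
    rewrite lee_fin; have := f_half _ uMd.
    by rewrite /u iterS -/(u M); lra.
  apply: eps_nbhd_measure_ge => //; first by case/andP: uNd.
  - move=> n Nn; rewrite {2}/u iterS -/(u n) opprB addrC subrK.
    apply: (@le_trans _ _ (f (u M.+1))); first exact: orbit_incr.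
    by apply: f_incr uN _; [case/andP: uNd|case/andP: ad].
  - exact: orbit_to0.
  - exact: orbit_noninc.
apply: (le_trans (@eps_nbhd_measure_le _ u M.+1 _ fa0 _ _)).
- by move=> n; case/andP: (orbit_in n).
- by move=> n; exact: orbit_noninc.
(* The ratio is estimated at index [M], the last one where the orbit is above [a], as [ratio_noninc]
   requires. *)
have Mfa : M%:R * f a <= a / (m - 1).
  rewrite ler_pdivlMr ?subr_gt0// mulrAC -ler_pdivlMr//.
  apply: (le_trans (orbit_ratio M)).
  by apply: ratio_noninc => //; [exact: ltW|case/andP: uMd].
(* With [f a <= a / 2], the bound [u M.+1 + 8 * f a + 4 * M * f a] is at most
   [a + 4 * a + 4 * a / (m - 1)]. *)
by rewrite lee_fin -natr1; move: uN fah Mfa; lra.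
Qed.

End orbit.

(** * Consequences of sublinearity near 0 *)

Section sublinear_near0.
Context (R : realType) (d m : R) (f : R -> R).
Hypotheses (m1 : 1 < m) (f_pos : forall x : R, 0 < x < d -> 0 < f x) (f0 : f 0 = 0)
  (f_cont : {within `[0, d[, continuous f})
  (f_der : forall x : R, 0 < x < d -> derivable f x 1)
  (f_der_half : forall x : R, 0 < x < d -> derive1 f x <= 1 / 2)
  (f_sub : forall x : R, 0 < x < d -> m * f x <= x * derive1 f x).

Lemma sublinear_derive1_gt0 (x : R) : 0 < x < d -> 0 < derive1 f x.
Proof.
move=> xd; have := f_sub _ xd; have := f_pos _ xd => fx mfx; have m_gt1 := m1.
have x0 : 0 < x by case/andP: xd.
by rewrite -(pmulr_rgt0 _ x0); apply: lt_le_trans mfx; rewrite mulr_gt0//; lra.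
Qed.

Lemma is_derive_derive1 (x : R) : 0 < x < d -> is_derive x 1 f (derive1 f x).
Proof. by move=> xd; rewrite derive1E; exact/derivableP/f_der. Qed.

Lemma sublinear_homo (x y : R) : 0 < x -> x <= y -> y < d -> f x <= f y.
Proof.
move=> x0; rewrite le_eqVlt => /predU1P[->//|xy] yd.
apply/ltW; apply: (@gtr0_derive1_lt_oo _ f 0 d) => //; rewrite ?in_itv/=; try lra.
- by move=> z; rewrite in_itv/=; exact: sublinear_derive1_gt0.
move=> z; rewrite inE => /f_der zd.
exact/differentiable_continuous/derivable1_diffP.
Qed.

Lemma sublinear_half (x : R) : 0 < x < d -> f x <= x / 2.
Proof.
move=> xd; have x0 : 0 < x by case/andP: xd.
have [||c] := @MVT _ f (derive1 f) 0 x x0.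
- move=> z; rewrite in_itv/= => zx; apply: is_derive_derive1; lra.
- apply: continuous_subspaceW f_cont => z /=; rewrite !in_itv/=; lra.
rewrite in_itv/= f0 !subr0 => /andP[c0 cx] ->.
have : derive1 f c <= 1 / 2 by apply: f_der_half; lra.
by rewrite -(ler_pM2r x0); lra.
Qed.

(** Mean value theorem for [H z = z / f z]: by [f_sub], the derivative (f c - c f'(c)) / f(c)^2 is
    at most -(m - 1) / f c, and [f c <= f y] since [c < y]. *)
Lemma sublinear_ratio (x y : R) : 0 < x -> x < y -> y < d ->
  (m - 1) * (y - x) / f y <= x / f x - y / f y.
Proof.
move=> x0 xy yd.
pose H (z : R) := z * (f z)^-1.
pose dH z := z * (- f z ^- 2 * derive1 f z) + (f z)^-1.
have H_der z : 0 < z < d -> is_derive z 1 H (dH z).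
  move=> zd; have fz : f z != 0 by rewrite gt_eqF// f_pos.
  have fVz := is_deriveV fz (is_derive_derive1 _ zd).
  have := is_deriveM (is_derive_id z 1) fVz.
  by move=> Hz; apply: is_derive_eq; rewrite /dH/= /GRing.scale/= mulr1.
have [||c] := @MVT _ H dH x y xy.
- move=> z; rewrite in_itv/= => zx; apply: H_der; lra.
- apply: derivable_within_continuous => z; rewrite in_itv/= => zx.
  by apply: (@ex_derive _ _ _ _ _ _ (dH z)); apply: H_der; lra.
rewrite in_itv/= => /andP[xc cy] Hxy.
have cd : 0 < c < d by lra.
have m_gt1 := m1.
have yd' : 0 < y < d by lra.
have fc := f_pos _ cd; have fy := f_pos _ yd'; have sc := f_sub _ cd.
have fcy : f c <= f y.
  by apply: sublinear_homo => //; lra.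
have dHc : dH c <= - (m - 1) / f y.
  apply: (@le_trans _ _ (- (m - 1) / f c)).
    have -> : dH c = (f c - c * derive1 f c) / (f c * f c).
      by rewrite /dH; field; rewrite gt_eqF.
    rewrite ler_pdivrMr ?mulr_gt0// mulrA mulfVK ?gt_eqF//; lra.
  by rewrite !mulNr lerN2 ler_wpM2l ?lef_pV2 ?posrE//; lra.
have : H y - H x <= - (m - 1) / f y * (y - x).
  by rewrite Hxy ler_wpM2r//; lra.
by rewrite /H; lra.
Qed.

End sublinear_near0.

Theorem theorem2p2 (R : realType) (delta : R) (r : option nat) (f : R -> R)
  (delta_gt0 : 0 < delta)
  (r_ge1 : le_reg 1 r)
  (f_cont : {within `[0, delta[, continuous f})
  (f_diffeo : Cr_diffeo_on r `]0, delta[ f)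
  (f_pos : forall x, 0 < x < delta -> 0 < f x)
  (f0 : f 0 = 0)
  (df0 : derive1 f x @[x --> 0^'+] --> 0)
  (f_sublinear : sublinear delta f) :
  let g := fun x : R => x - f x in
  let finv := pinv `]0, delta[ f in
  \forall x0 \near 0^'+,
    simeq0 (fun eps => fine (lebesgue_measure (eps_nbhd (orbit_set g x0) eps)))
           finv.
Proof.
move=> g finv.
have [f_inj [f_der _] _] := f_diffeo.
have {}f_der (x : R) : 0 < x < delta -> derivable f x 1.
  by move=> xd; apply: (f_der 0%N) => //=; rewrite in_itv.
have [d1 [m [d1_gt0 d1_le m1 f_log]]] := f_sublinear.
have f_sub (x : R) : 0 < x < d1 -> m * f x <= x * derive1 f x.
  move=> xd; have xd' : 0 < x < delta by lra.
  have fx := f_pos _ xd'; have := f_log _ xd.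
  (* The logarithmic derivative is f'/f; multiplying by [f x > 0] clears the denominator. *)
  rewrite (@derive1_comp _ f (@ln R)) //; [|exact: f_der|]; last first.
    by apply: ex_derive; exact: is_derive1_ln.
  rewrite [derive1 (@ln R) _]derive1E (derive_val (is_derive := is_derive1_ln fx)).
  by rewrite mulrCA ler_pdivlMl// mulrC.
have : \forall x \near 0^'+, derive1 f x <= 1 / 2.
  have /cvgrPdist_le /(_ (1 / 2)) := df0.
  move=> /(_ ltac:(lra)); apply: filterS => x.
  by rewrite sub0r normrN ler_norml => /andP[].
case=> e /= e0 He.
pose d := Num.min d1 e.
have d0 : 0 < d by rewrite lt_min d1_gt0.
have dP (x : R) : 0 < x < d -> [/\ 0 < x < d1, 0 < x < delta & derive1 f x <= 1 / 2].
  rewrite lt_min => /and3P[x0 xd1 xe]; split; [lra|lra|].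
  by apply: He => //=; rewrite sub0r normrN gtr0_norm.
have fd_pos (x : R) : 0 < x < d -> 0 < f x by case/dP => _ /f_pos.
have fd_cont : {within `[0, d[, continuous f}.
  apply: continuous_subspaceW f_cont => z /=; rewrite !in_itv/= lt_min; lra.
have fd_der (x : R) : 0 < x < d -> derivable f x 1 by case/dP => _ /f_der.
have fd_half (x : R) : 0 < x < d -> derive1 f x <= 1 / 2 by case/dP.
have fd_sub (x : R) : 0 < x < d -> m * f x <= x * derive1 f x by case/dP => /f_sub.
have fd_incr := sublinear_homo _ _ _ _ m1 fd_pos fd_der fd_sub.
have fd_le := sublinear_half _ _ _ f0 fd_cont fd_der fd_half.
have fd_ratio := sublinear_ratio _ _ _ _ m1 fd_pos fd_der fd_sub.
near=> x0.
have x0d : 0 < x0 < d.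
  by apply/andP; split; near: x0; [exact: nbhs_right_gt|exact: nbhs_right_lt].
(* The threshold [f x0] on [eps] puts the preimage [a] of [eps] strictly below [x0]. *)
exists (1 / 2), (5 + 4 / (m - 1)), (f x0); split => //.
- by rewrite addr_gt0// divr_gt0//; lra.
- exact: fd_pos.
move=> eps /andP[eps0 epsx0].
have [|||a] := @IVT _ f 0 x0 eps.
- lra.
- apply: continuous_subspaceW fd_cont => z /=; rewrite !in_itv/=; lra.
- by rewrite f0 ge_min le_max ltW//= (ltW epsx0) orbT.
(* The endpoints are excluded because [eps] differs from both [f 0 = 0] and [f x0]. *)
rewrite in_itv/= => /andP[a_ge0 a_le] fa.
have a0 : 0 < a.
  by rewrite lt_neqAle a_ge0 andbT; apply/eqP => a0; move: fa; rewrite -a0 f0; lra.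
have ax0 : a < x0.
  by rewrite lt_neqAle a_le andbT; apply/eqP => ax0; move: fa; rewrite ax0; lra.
have -> : finv eps = a.
  rewrite -fa /finv pinvKV// inE/= in_itv/=.
  by have [|_] // := dP a; lra.
have := orbit_nbhd_measure _ _ _ _ m1 fd_pos fd_incr fd_le fd_ratio _ x0d _ a0 ax0.
rewrite fa -/g -/(orbit_set g x0).
(* [fine] sends infinite values to 0; the two-sided bound rules these out. *)
case: (lebesgue_measure _) => [v| |]; rewrite ?leey ?leNye ?andbF//=.
by rewrite !lee_fin => vbounds; rewrite ler_pdivlMr // ler_pdivrMr //; lra.
Unshelve. all: by end_near. Qed.
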